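(* Let $\alpha^*=\alpha+\lambda T$ be a $T$-$P^*$ associated curve of $\alpha$ (with respect to some real constants $c,d$, not both zero), with $s$ ranging over an interval. Then there is a constant $k\in\mathbb{R}$ such that the distance between corresponding points of $\alpha$ and $\alpha^*$ in $E^3$ is $$d(\alpha^*(s),\alpha(s))=|-s+k|.$$
   Context: $\alpha$ is a smooth curve in $E^3$ parametrized by arc length $s$, with Frenet frame $\{T,N,B\}$, curvature $\kappa>0$ and torsion $\tau$: $T'=\kappa N$, $N'=-\kappa T+\tau B$, $B'=-\tau N$. For a curve $\alpha^*$ with the same parameter $s$ (regular, not necessarily unit speed, with ${\alpha^*}'\wedge{\alpha^*}''\ne 0$), $T^*={\alpha^*}'/\|{\alpha^*}'\|$, $B^*=({\alpha^*}'\wedge{\alpha^*}'')/\|{\alpha^*}'\wedge{\alpha^*}''\|$, $N^*=B^*\wedge T^*$. For real constants $c,d$ put $P^*=\frac{cN^*+dB^*}{\sqrt{c^2+d^2}}$. The curve $\alpha^*$ is called a $T$-$P^*$ associated curve of $\alpha$ if $\alpha^*=\alpha+\lambda T$ for a smooth real function $\lambda$ of $s$ and $T$ is linearly dependent with $P^*$, normalized so that $T=P^*$. *)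

(* Defs.v *)
From mathcomp Require Import all_boot all_order all_algebra.
From mathcomp Require Import all_classical all_reals all_analysis.

Set Implicit Arguments.
Unset Strict Implicit.
Unset Printing Implicit Defensive.

Import Order.TTheory GRing.Theory Num.Theory.
Import numFieldNormedType.Exports.

Local Open Scope classical_set_scope.
Local Open Scope ring_scope.

(* The library's [derive1] needs the function to be given around the point. On
   an interval [I] that may contain its endpoints the increments [h] are
   restricted to those with [h + s] in [I], so the derivative is one-sided at an
   endpoint and [derive1] inside (lemma [derive_on_interior] below). *)
Section DeriveOn.
Context {R : realType} {V : normedModType R}.
Implicit Types (I : set R) (f : R -> V) (s : R) (v : V).

Definition incr_filter I s := within [set h : R | I (h + s)] 0^'.

Definition derive_on I f s : V :=
  lim ((fun h : R => h^-1 *: (f (h + s) - f s)) @ incr_filter I s).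

Definition derivable_on I f s : Prop :=
  cvg ((fun h : R => h^-1 *: (f (h + s) - f s)) @ incr_filter I s).

Definition is_derive_on I f s v : Prop :=
  derivable_on I f s /\ derive_on I f s = v.

Definition smooth_on I f : Prop :=
  forall (n : nat) s, I s -> derivable_on I (iter n (derive_on I) f) s.

Lemma derive_on_interior I f s : I° s -> derive_on I f s = derive1 f s.
Proof.
move=> Is; suff eI : incr_filter I s = 0^' by rewrite /derive_on eI.
have nI : \forall h \near 0^', I (h + s).
  have cs : (fun h : R => h + s) @ (0 : R) --> s.
    rewrite -[X in _ --> X]add0r.
    exact: (@cvgD R R^o R (nbhs (0 : R)) _ id (cst s) 0 s cvg_id (cvg_cst _)).
  by apply: cvg_within; exact: cs Is.
apply/seteqP; split=> P; last exact: cvg_within.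
move=> wP; have {}wP : \forall h \near 0^', I (h + s) -> P h := wP.
by apply: filterS2 nI wP => h Ih; apply.
Qed.

End DeriveOn.

(* Euclidean geometry of E^3: the library's norm [`|u|] on matrices is the
   sup norm, hence [euclid_norm]. *)
Section E3.
Context {R : realType}.
Implicit Types u v : 'rV[R]_3.

Definition dot u v : R := (u *m v^T) 0 0.

Definition euclid_norm u : R := Num.sqrt (dot u u).

Definition euclid_dist u v : R := euclid_norm (u - v).

Definition cross u v : 'rV[R]_3 :=
  \row_(i < 3) [:: u 0 1 * v 0 2 - u 0 2 * v 0 1;
                   u 0 2 * v 0 0 - u 0 0 * v 0 2;
                   u 0 0 * v 0 1 - u 0 1 * v 0 0]`_i.

End E3.

Section Curves.
Context {R : realType}.
Implicit Types (I : set R) (alpha beta T N B : R -> 'rV[R]_3).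
Implicit Types (kappa tau : R -> R) (c d s : R).

(* The condition [dot (T s) (T s) = 1] says that [alpha] is parametrized by
   arc length. *)
Definition frenet_frame I alpha T N B kappa tau : Prop :=
  forall s, I s ->
  [/\ is_derive_on I alpha s (T s),
      [/\ dot (T s) (T s) = 1, dot (N s) (N s) = 1, dot (T s) (N s) = 0
        & B s = cross (T s) (N s)],
      0 < kappa s
    & [/\ is_derive_on I T s (kappa s *: N s),
          is_derive_on I N s (- kappa s *: T s + tau s *: B s)
        & is_derive_on I B s (- tau s *: N s)]].

(* Frame of a curve with arbitrary regular parameter. *)
Definition tangent I beta s : 'rV[R]_3 :=
  let b1 := derive_on I beta s in (euclid_norm b1)^-1 *: b1.

Definition binormal I beta s : 'rV[R]_3 :=
  let b12 := cross (derive_on I beta s) (derive_on I (derive_on I beta) s) in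
  (euclid_norm b12)^-1 *: b12.

Definition principal_normal I beta s : 'rV[R]_3 :=
  cross (binormal I beta s) (tangent I beta s).

Definition Pvec I c d beta s : 'rV[R]_3 :=
  (Num.sqrt (c ^+ 2 + d ^+ 2))^-1 *:
    (c *: principal_normal I beta s + d *: binormal I beta s).

(* [beta] is a T-P* associated curve of the curve [alpha] with unit tangent
   [T], with respect to the constants [c], [d]. *)
Definition TP_associated I c d alpha T beta : Prop :=
  [/\ exists2 lambda : R -> R, smooth_on I lambda &
        forall s, I s -> beta s = alpha s + lambda s *: T s,
      forall s, I s -> derive_on I beta s != 0,
      forall s, I s ->
        cross (derive_on I beta s) (derive_on I (derive_on I beta) s) != 0
    & forall s, I s -> T s = Pvec I c d beta s].

End Curves.

(* Main.v *)
(** Since [alphas = alpha + lambda T], Frenet's equations give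
    [alphas' = (1 + lambda') T + lambda kappa N]. Both [N*] and [B*] are
    orthogonal to [alphas'], hence so is [T = P*], which forces [lambda' = -1].
    Thus [lambda s = - s + k], and the distance is [|lambda s|] because [T] is
    a unit vector. *)
Require Import Defs.
From mathcomp Require Import all_boot all_order all_algebra.
From mathcomp Require Import all_classical all_reals all_analysis.
From mathcomp Require Import ring lra.
Import Order.TTheory GRing.Theory Num.Theory.
Import numFieldNormedType.Exports.
Local Open Scope classical_set_scope.
Local Open Scope ring_scope.
Section DeriveOnInterval.
Set Implicit Arguments.
Unset Strict Implicit.
Context {R : realType}.
Implicit Types (I : set R) (s : R).

#[local] Instance incr_filter_filter I s : Filter (incr_filter I s).
Proof. exact: within_filter. Qed.

(** Properness makes limits along [incr_filter] unique, so that the [lim] in [derive_on] can be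
    computed. It holds because [I] has a second point [y], and by convexity the increments
    [t * (y - s)] with small positive [t] are admissible. *)
Lemma incr_filter_proper I s :
  is_interval I -> I° !=set0 -> I s -> ProperFilter (incr_filter I s).
Proof.
move=> itvI [x Ix] Is; have [y Iy ys] : exists2 y, I y & y != s.
  have [xs|] := eqVneq x s; last by exists x => //; exact: interior_subset.
  have [e /= e0 eI] : exists2 e : R, 0 < e & ball x e `<=` I.
    by move/nbhs_ballP : Ix => [e /= e0 eI]; exists e.
  exists (x + e / 2).
    apply: eI; rewrite /ball /= opprD addNKr normrN gtr0_norm ?divr_gt0 //.
    by rewrite ltr_pdivrMr // ltr_pMr // ltr1n.
  by rewrite -xs -subr_eq0 addrAC subrr add0r gt_eqF ?divr_gt0.
rewrite /incr_filter; split; last exact: within_filter.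
rewrite /within /= => /nbhs_ballP[e /= e0] /=.
have ys0 : 0 < `|y - s| by rewrite normr_gt0 subr_eq0.
have d0 : 0 < e / (2 * (e + `|y - s|)).
  by rewrite divr_gt0 // mulr_gt0 // addr_gt0.
(* This [t] meets two demands at once: [t <= 1] keeps [t * (y - s) + s] between [s] and [y], and
   [t * |y - s| < e] keeps the increment in the ball. *)
set t := e / (2 * (e + `|y - s|)) in d0.
have dpos : 0 < 2 * (e + `|y - s|) by rewrite mulr_gt0 // addr_gt0.
have t1 : t <= 1 by rewrite ler_pdivrMr // mul1r; nra.
have te : t * `|y - s| < e by rewrite /t mulrAC ltr_pdivrMr //; nra.
move=> /(_ (t * (y - s))); apply.
- by rewrite /ball /= sub0r normrN normrM (gtr0_norm d0).
- by rewrite mulf_neq0 ?subr_eq0 // gt_eqF.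
- rewrite /=; case: (leP s y) => sy.
    by apply: (itvI _ _ Is Iy); nra.
  by apply: (itvI _ _ Iy Is); nra.
Qed.

(** For [h != 0], [f (h + s)] is [h] times the difference quotient plus [f s], and the first term
    tends to 0. *)
Lemma derivable_on_cvg {V : normedModType R} I (f : R -> V) s :
  derivable_on I f s -> (fun h : R => f (h + s)) @ incr_filter I s --> f s.
Proof.
move=> df.
have h0 : (id : R -> R) @ incr_filter I s --> 0.
  by move=> P P0; exact: (cvg_within _ (nbhs_dnbhs P0)).
have := cvgD (cvgZ h0 df) (cvg_cst (f s)).
rewrite scale0r add0r => qs.
apply: (cvg_trans _ (qs _ _ _)); apply: near_eq_cvg.
have : \forall h \near incr_filter I s, h != 0.
  exact: (cvg_within _ (nbhs_dnbhs_neq _)).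
apply: filterS => h hn0.
by rewrite !fctE scalerA divff // scale1r subrK.
Qed.

Lemma derivable_on_continuous {V : normedModType R} I (f : R -> V) :
  (forall s, I s -> derivable_on I f s) -> {within I, continuous f}.
Proof.
move=> df; apply/subspace_continuousP => s Is P fP.
have h0 : \forall h \near (0 : R)^', I (h + s) -> P (f (h + s)).
  exact: (derivable_on_cvg (df s Is) fP).
have sP : \forall h \near (0:R), I (h + s) -> P (f (h + s)).
  move: h0 => /nbhs_ballP[e /= e0 eP].
  apply/nbhs_ballP; exists e => //= h he Ih.
  (* The punctured filter says nothing about [h = 0]; there the value is [f s] itself. *)
  have [->|hn0] := eqVneq h 0; last exact: eP.
  by rewrite add0r; exact: nbhs_singleton.
move: sP => /nbhs_ballP[e /= e0 eP]; rewrite /= /within /=.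
apply/nbhs_ballP; exists e => //= x xe Ix.
have := eP (x - s); rewrite subrK; apply=> //.
by move: xe; rewrite /ball /= sub0r opprB.
Qed.

(** Near an interior point every small increment stays in [I], so the restricted limit is the
    two-sided one that the mean value theorem asks for. *)
Lemma derivable_on_is_derive I (f : R -> R) s :
  I° s -> derivable_on I f s -> is_derive s 1 f (derive_on I f s).
Proof.
move=> Is df.
have nI : \forall h \near (0 : R)^', I (h + s).
  apply: nbhs_dnbhs; move: Is => /nbhs_ballP[e /= e0 eI].
  apply/nbhs_ballP; exists e => //= h; rewrite /ball /= sub0r normrN => he.
  by apply: eI; rewrite /ball /= opprD addrCA subrr addr0 normrN.
have qf : (fun h : R => h^-1 *: (f (h + s) - f s)) @ 0^' --> derive_on I f s.
  move=> P /df fP; have {}fP : \forall h \near (0 : R)^',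
    I (h + s) -> P (h^-1 *: (f (h + s) - f s)) by exact: fP.
  by apply: filterS2 nI fP => h Ih; apply.
have qf' : h^-1 *: ((f \o shift s) (h *: 1) - f s) @[h --> 0^']
    --> derive_on I f s.
  by under eq_fun do rewrite /= [_ *: 1]mulr1.
apply: DeriveDef; first by apply/cvg_ex; exists (derive_on I f s).
exact: cvg_lim.
Qed.

(** Mean value theorem on [[s, t]]: points strictly between are interior to [I], while at [s] and
    [t], possibly endpoints of [I], continuity within [I] suffices. *)
Lemma derive_on_cst_diff I (f : R -> R) (m : R) : is_interval I ->
  (forall s, I s -> is_derive_on I f s m) ->
  forall s t, I s -> I t -> f t - f s = m * (t - s).
Proof.
move=> itvI df.
have fE s t : s < t -> I s -> I t -> f t - f s = m * (t - s).
  move=> st Is It.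
  have stI : `[s, t] `<=` I.
    by move=> x /=; rewrite in_itv /=; exact: itvI.
  have [x xst | | x _ ->//] := @MVT R f (fun=> m) s t st.
    have xI : I° x.
      apply: (@interiorS _ [set` `]s, t[]).
        by move=> y /subset_itv_oo_cc /stI.
      by rewrite ((interior_id _).1 (interval_open _ _)).
    have [dx <-] := df x (interior_subset xI).
    exact: derivable_on_is_derive.
  apply: (@continuous_subspaceW _ _ _ I) => //.
  by apply: derivable_on_continuous => x /df[].
move=> s t Is It; have [st|ts|->] := ltgtP s t; first exact: fE.
  by rewrite -opprB fE // -mulrN opprB.
by rewrite !subrr mulr0.
Qed.

(** Sum and product rules together. Agreement of [h] with [f + l *: g] on [I] is enough, since the
    quotients sample only points of [I]. *)
Lemma derive_on_addZ {V : normedModType R} I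
    (f g h : R -> V) (l : R -> R) s :
  ProperFilter (incr_filter I s) -> I s ->
  (forall t, I t -> h t = f t + l t *: g t) ->
  derivable_on I f s -> derivable_on I l s -> derivable_on I g s ->
  derive_on I h s =
    derive_on I f s + (derive_on I l s *: g s + l s *: derive_on I g s).
Proof.
move=> FI Is hE df dl dg; apply: cvg_lim; first exact: norm_hausdorff.
(* Leibniz splitting through the mixed term [l (x + s) *: g s]; the leftover factor [l (x + s)]
   converges by continuity of [l]. *)
have qh : x^-1 *: (f (x + s) - f s)
      + ((x^-1 * (l (x + s) - l s)) *: g s
         + l (x + s) *: (x^-1 *: (g (x + s) - g s))) @[x --> incr_filter I s]
    --> derive_on I f s + (derive_on I l s *: g s + l s *: derive_on I g s).
  apply: cvgD; first exact: df.
  apply: cvgD; first by apply: cvgZ; [exact: dl | exact: cvg_cst].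
  by apply: cvgZ; [exact: derivable_on_cvg | exact: dg].
apply: (cvg_trans _ qh); apply: near_eq_cvg.
have : \forall x \near incr_filter I s, I (x + s).
  by rewrite /incr_filter /within /prop_near1 /=; exact: nearW.
apply: filterS => x Ix.
rewrite !hE // -scalerA [l (x + s) *: (x^-1 *: _)]scalerA.
rewrite [l (x + s) * _]mulrC -scalerA -!scalerDr.
congr (_ *: _).
rewrite scalerBl scalerBr [_ *: _ - _ + _]addrC !addrA subrK.
by rewrite opprD addrA; congr (_ - _); rewrite addrAC.
Qed.

End DeriveOnInterval.

Section E3Algebra.
Set Implicit Arguments.
Unset Strict Implicit.
Context {R : realType}.
Implicit Types (u v w : 'rV[R]_3) (a : R).

Lemma dotDl u v w : dot (u + v) w = dot u w + dot v w.
Proof. by rewrite /dot mulmxDl mxE. Qed.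

Lemma dotZl a u v : dot (a *: u) v = a * dot u v.
Proof. by rewrite /dot -scalemxAl mxE. Qed.

Lemma dotE u v : dot u v = u 0 0 * v 0 0 + u 0 1 * v 0 1 + u 0 2 * v 0 2.
Proof.
rewrite /dot mxE !big_ord_recl big_ord0 addr0 !mxE addrA.
by congr (_ + _ * _ + _ * _); congr (_ _ _); apply: val_inj.
Qed.

Lemma dotC u v : dot u v = dot v u.
Proof. by rewrite !dotE; ring. Qed.

Lemma dot_crossl u v : dot (cross u v) u = 0.
Proof. by rewrite dotE !mxE /=; ring. Qed.

Lemma dot_crossr u v : dot (cross u v) v = 0.
Proof. by rewrite dotE !mxE /=; ring. Qed.

Lemma euclid_normZ a u : euclid_norm (a *: u) = `|a| * euclid_norm u.
Proof.
rewrite /euclid_norm dotZl dotC dotZl mulrA -expr2.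
by rewrite sqrtrM ?sqr_ge0 // sqrtr_sqr.
Qed.

Lemma cross_Zr a u v : cross u (a *: v) = a *: cross u v.
Proof.
apply/rowP => i; rewrite !mxE; case: i => -[|[|[|]]] //= _; ring.
Qed.

(** The normalizing factors come out as scalars, leaving cross products that have the derivative of
    [beta] as one factor. *)
Lemma dot_Pvec_derive I c d (beta : R -> 'rV[R]_3) s :
  dot (Pvec I c d beta s) (derive_on I beta s) = 0.
Proof.
rewrite /Pvec /principal_normal /tangent cross_Zr dotZl dotDl !dotZl.
by rewrite dot_crossr dot_crossl !mulr0 addr0 mulr0.
Qed.

End E3Algebra.

Theorem theorem2p6 (R : realType) (I : set R)
    (alpha T N B : R -> 'rV[R]_3) (kappa tau : R -> R)
    (c d : R) (alphas : R -> 'rV[R]_3)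
    (I_interval : is_interval I) (I_nondegenerate : I° !=set0)
    (alpha_smooth : smooth_on I alpha)
    (alpha_frenet : frenet_frame I alpha T N B kappa tau)
    (cd_neq0 : ~ (c = 0 /\ d = 0))
    (alphas_assoc : TP_associated I c d alpha T alphas) :
  exists k : R, forall s : R, I s ->
    euclid_dist (alphas s) (alpha s) = `| - s + k |.
Proof.
case: alphas_assoc => -[lam lam_smooth asE] _ _ TP.
have dlam s : I s -> is_derive_on I lam s (-1).
  move=> Is; split; first exact: (lam_smooth 0%N).
  have FI := incr_filter_proper I_interval I_nondegenerate Is.
  have [[da Da] [TT _ TN _] _ [[dT DT] _ _]] := alpha_frenet s Is.
  have := dot_Pvec_derive I c d alphas s.
  rewrite -(TP s Is) (derive_on_addZ FI Is asE da (lam_smooth 0%N s Is) dT).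
  (* Pairing the derivative of [alphas] with [T s] kills the [N s] term and leaves
     [1 + derive_on I lam s = 0]. *)
  rewrite Da DT dotC 2!dotDl !dotZl TT (dotC (N s)) TN mulr1 !mulr0 addr0.
  by move=> /eqP; rewrite addrC addr_eq0 => /eqP.
have [s0 /interior_subset Is0] := I_nondegenerate.
(* As [lam] has slope -1, [lam s + s] is constant on [I]; [k] is its value at the reference point
   [s0]. *)
exists (lam s0 + s0) => s Is.
have [_ [TT _ _ _] _ _] := alpha_frenet s Is.
rewrite /euclid_dist asE // addrC addKr euclid_normZ /euclid_norm TT.
rewrite sqrtr1 mulr1.
have := derive_on_cst_diff I_interval dlam Is0 Is.
by move=> lamE; congr `|_|; lra.
Qed.
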